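(* Let $u_0\in \mathrm{BV}_{\mathrm{loc}}([0,+\infty))$ be nonnegative and right-continuous. Then the nonlocal equation $$\ell(t)=u_0(t)+\bigl|\{\,s\in[0,t]:\ \ell(t-s)>s\,\}\bigr|\qquad\forall t\in[0,+\infty),\qquad (\ast)$$ in the nonnegative unknown $\ell\in \mathrm{BV}_{\mathrm{loc}}([0,+\infty))$, has a solution, and the solution is unique provided $u_0$ is positive in a right neighbourhood of the origin (i.e. there is $\delta>0$ with $u_0>0$ on $[0,\delta)$). In addition, a solution $\ell$ cannot have increasing jumps unless $u_0$ has increasing jumps, while it may have decreasing jumps (i.e. there are admissible $u_0$ for which $\ell$ has a decreasing jump). Moreover, for a solution $\ell$ of $(\ast)$, the function $$v(\tau,\xi):=u_0(\xi)+\bigl|\{\,s\in[0,\tau]:\ \ell(s)+s>\xi\,\}\bigr|,\qquad \tau>0,\ \xi>\tau,$$ satisfies: (a) $v$ is the unique solution, globally defined on $\{(\tau,\xi):\tau>0,\ \xi>\tau\}$, of the integral problem $$w(\tau,\xi)=u_0(\xi)+\int_0^\tau 1_{(\xi,+\infty)}\bigl(w(s,s)+s\bigr)\,ds,\qquad \tau>0,\ \xi>\tau,$$ having the generalized graph of $\ell$ as free boundary, that is, whose trace satisfies $w(\tau,\tau)=\ell(\tau)$ for every $\tau>0$; (b) $v$ satisfies the conservation of mass: $\int_\tau^{+\infty}v(\tau,\xi)\,d\xi=\int_0^{+\infty}u_0(\xi)\,d\xi$ (as elements of $[0,+\infty]$) for every $\tau>0$; (c) $v(\tau,\cdot)$ satisfies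 a unilateral Lipschitz condition provided $u_0$ does: if there is $C>0$ with $u_0(\xi+h)-u_0(\xi)\le Ch$ for all $\xi\ge 0$, $h>0$, then for each $\tau>0$ there is $C'>0$ with $v(\tau,\xi+h)-v(\tau,\xi)\le C'h$ for all $\xi>\tau$, $h>0$.
   Context: $|\cdot|$ denotes one-dimensional Lebesgue measure and $1_A$ the characteristic function of a set $A$. $\mathrm{BV}_{\mathrm{loc}}([0,+\infty))$ is the class of all functions on $[0,+\infty)$ having finite pointwise variation on $[0,a]$ for every $a>0$. All functions are Lebesgue measurable. A function in this class has an increasing (resp. decreasing) jump at $t>0$ if its left limit at $t$ is strictly smaller (resp. strictly larger) than its right limit at $t$. A solution of the integral problem is a locally bounded function $w:\{(\tau,\xi):\tau>0,\xi>\tau\}\to[0,+\infty)$, defined everywhere, such that for every $\tau>0$ the limit $w(\tau,\tau):=\lim_{\xi\to\tau^+}w(\tau,\xi)$ exists in $[0,+\infty)$, and such that the integral equation holds at every $(\tau,\xi)$ with $\tau>0$, $\xi>\tau$. In these coordinates the free boundary of $w$ is $\{(\tau,\xi):\xi>\tau,\ \xi=w(\tau,\tau)+\tau\}$; in the original coordinates $t=\tau$, $x=\xi-\tau$ it is the graph of $\tau\mapsto w(\tau,\tau)$. The generalized graph of a $\mathrm{BV}_{\mathrm{loc}}$ function is its graph with the addition of vertical segments joining left and right limits at jump points. *)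

(* Defs.v *)
From HB Require Import structures.
From mathcomp Require Import all_boot all_order all_algebra.
From mathcomp Require Import all_classical all_reals all_analysis.
From mathcomp Require Import measurable_realfun.

Set Implicit Arguments.
Unset Strict Implicit.
Unset Printing Implicit Defensive.
Import Order.TTheory GRing.Theory Num.Theory.
Import numFieldNormedType.Exports.

Local Open Scope classical_set_scope.
Local Open Scope ring_scope.

(* A function on [0, +oo[ is represented by a function R -> R of which only
   the values on [0, +oo[ matter; similarly for functions on [wedge]. *)

Section free_boundary_definitions.
Context {R : realType}.
Implicit Types (f u l : R -> R) (w : R * R -> R) (A : set R) (t tau xi : R).

Definition BVloc f := forall a, 0 < a -> bounded_variation 0 a f.

Definition nonneg f := forall t, 0 <= t -> 0 <= f t.

Definition admissible_datum u0 :=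
  [/\ BVloc u0, nonneg u0 & forall t, 0 <= t -> u0 x @[x --> t^'+] --> u0 t].

Definition increasing_jump f t :=
  exists a b, [/\ f x @[x --> t^'-] --> a, f x @[x --> t^'+] --> b & a < b].

Definition decreasing_jump f t :=
  exists a b, [/\ f x @[x --> t^'-] --> a, f x @[x --> t^'+] --> b & b < a].

(* Real-valued Lebesgue measure, used below for bounded sets only. *)
Definition lebesgue_length A : R := fine (lebesgue_measure A).

(* Lebesgue measurability is not repeated here: it follows from [BVloc]. *)
Definition nonlocal_solution u0 l :=
  [/\ BVloc l, nonneg l & forall t, 0 <= t ->
      l t = u0 t + lebesgue_length [set s | 0 <= s <= t /\ s < l (t - s)]].

Definition wedge : set (R * R) := [set p | 0 < p.1 /\ p.1 < p.2].

(* Lebesgue, not merely Borel, measurability in the plane: preimages of Borel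
   sets belong to the completion of the product sigma-algebra. *)
Definition lebesgue_measurable_on (D : set (R * R)) w :=
  forall B : set R, measurable B ->
    completed_algebra_gen (@lebesgue_measure R \x @lebesgue_measure R)%E
      (D `&` w @^-1` B).

Definition diag_trace w tau : R := lim (w (tau, xi) @[xi --> tau^'+]).

(* The value [diag_trace w 0] is meaningless, whence the integral over ]0, tau]. *)
Definition integral_solution u0 w :=
  [/\ forall p, wedge p -> 0 <= w p,
      [locally [bounded w p | p in wedge]],
      lebesgue_measurable_on wedge w,
      forall tau, 0 < tau -> cvg (w (tau, xi) @[xi --> tau^'+]) &
      forall tau xi, 0 < tau -> tau < xi ->
        w (tau, xi) = u0 xi +
          \int[lebesgue_measure]_(s in `]0, tau]) \1_(`]xi, +oo[) (diag_trace w s + s)].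

(* The free boundary {(tau, xi) | xi = w(tau, tau) + tau} is the graph of l
   in the coordinates (tau, xi - tau). *)
Definition has_free_boundary w l := forall tau, 0 < tau -> diag_trace w tau = l tau.

Definition v_of u0 l : R * R -> R := fun p =>
  u0 p.2 + lebesgue_length [set s | 0 <= s <= p.1 /\ p.2 < l s + s].

End free_boundary_definitions.

(* Main.v *)
Require Import Defs.
From HB Require Import structures.
From mathcomp Require Import all_boot all_order all_algebra.
From mathcomp Require Import all_classical all_reals all_analysis.
From mathcomp Require Import lra measurable_realfun.

(** Reflecting [s] into [t - s] turns the equation into
    l(t) = u0(t) + e(t, t), where e(tau, xi), the [exceedance] below, is the
    length of {s in [0, tau] : l(s) + s > xi}; moreover
    v(tau, xi) = u0(xi) + e(tau, xi).  All the claims come from the way in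
    which e depends on l, tau and xi.

    - Bounded variation and jumps.  Moving from t1 to t2 > t1 enlarges the set
      behind e(t, t) by at most ]t1, t2], so t - e(t, t) is nondecreasing for
      every function l whatsoever
      ([sub_exceedance_diag_nondecreasing]).  Hence l - u0 is the identity
      minus a nondecreasing function: it has locally bounded variation and
      only decreasing jumps, and a decreasing jump of u0 survives in l.

    - Existence.  e is monotone in l, so the map sending l to u0 + e is monotone
      on the functions between 0 and u0(t) + t; the supremum of its subsolutions
      is a fixed point, as in the Knaster-Tarski theorem
      ([diagonal_solution_exists]).  That supremum need not be measurable a
      priori, but the outer measure makes sense of e anyway, and the fixed
      point has locally bounded variation by the previous item.

    - Uniqueness.  If u0 >= c > 0 on [0, c], then every solution is >= c
      everywhere ([diagonal_solution_ge]).  So l(s) + s > t holds for all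
      s in ]t - c, t], the value l(t) depends only on l over [0, t - c], and
      two solutions agree on [0, n c] for every n by induction.

    - The integral problem.  By continuity of the measure from below,
      e(tau, xi) tends to e(tau, tau) as xi decreases to tau
      ([exceedance_right_cvg]), so the trace of v is l; a solution of the
      integral problem is determined by its trace.

    - Conservation of mass.  Tonelli's theorem for the planar set
      {(s, x) : 0 <= s <= tau, s <= x < l(s) + s} equates the integral of l
      over [0, tau] with the integral of e(x, x) over [0, tau] plus that of
      e(tau, x) over ]tau, +oo[ ([exceedance_tonelli]).  Since l = u0 + e on the
      diagonal, cancelling the finite integral of e(x, x) shows that the mass
      of u0 on [0, tau] is the mass of e(tau, .) beyond tau.

    - The unilateral Lipschitz bound.  e(tau, xi) is nonincreasing in xi, so v
      inherits the constant of u0. *)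

Set Implicit Arguments.
Unset Strict Implicit.
Unset Printing Implicit Defensive.
Import Order.TTheory GRing.Theory Num.Theory.
Import numFieldNormedType.Exports.

Local Open Scope classical_set_scope.
Local Open Scope ring_scope.

Lemma measurable_bool_set (d : measure_display) (T : measurableType d)
  (b : T -> bool) : measurable_fun [set: T] b -> measurable [set x | b x].
Proof.
move=> mb; rewrite -[X in measurable X]setTI.
exact: (mb measurableT [set true]).
Qed.

Section free_boundary.
Context {R : realType}.
Implicit Types (A B : set R) (f u l : R -> R) (t tau xi : R).

Local Notation mu := (@lebesgue_measure R).

(** * The exceedance function *)

(** Lebesgue measure is defined as the restriction of an outer measure, hence
    monotone and subadditive on arbitrary sets.  This generality is what the
    existence proof needs, since it applies the exceedance to functions that
    are not known to be measurable. *)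
Lemma lebesgue_measure_mono A B : A `<=` B -> (mu A <= mu B)%E.
Proof.
move=> AB; rewrite /lebesgue_measure /lebesgue_stieltjes_measure.
exact: le_outer_measure.
Qed.

Lemma lebesgue_measureU2 A B : (mu (A `|` B) <= mu A + mu B)%E.
Proof.
by rewrite /lebesgue_measure /lebesgue_stieltjes_measure outer_measureU2.
Qed.

Lemma lebesgue_measure_cc (a b : R) : a <= b -> mu `[a, b] = (b - a)%:E.
Proof.
rewrite lebesgue_measure_itv/= lte_fin le_eqVlt => /predU1P[->|->] //.
by rewrite ltxx subrr.
Qed.

Definition exceed_set l tau xi := [set s : R | 0 <= s <= tau /\ xi < l s + s].

Definition exceedance l tau xi : R := lebesgue_length (exceed_set l tau xi).

Lemma exceed_set_sub l tau xi : exceed_set l tau xi `<=` `[0, tau].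
Proof. by move=> s []; rewrite /= in_itv. Qed.

Lemma exceed_set_fin l tau xi : mu (exceed_set l tau xi) \is a fin_num.
Proof.
rewrite ge0_fin_numE//.
have /lebesgue_measure_mono := @exceed_set_sub l tau xi.
move=> /le_lt_trans; apply.
by rewrite lebesgue_measure_itv/=; case: ifP; rewrite ltry.
Qed.

Lemma exceedanceE l tau xi :
  (exceedance l tau xi)%:E = mu (exceed_set l tau xi).
Proof. by rewrite /exceedance /lebesgue_length fineK// exceed_set_fin. Qed.

Lemma exceedance_ge0 l tau xi : 0 <= exceedance l tau xi.
Proof. by rewrite -lee_fin exceedanceE. Qed.

Lemma exceedance_le l tau xi : 0 <= tau -> exceedance l tau xi <= tau.
Proof.
move=> tau0; rewrite -lee_fin exceedanceE -[tau in leRHS]subr0.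
rewrite -lebesgue_measure_cc//.
exact/lebesgue_measure_mono/exceed_set_sub.
Qed.

Lemma exceedance_lt0 l tau xi : tau < 0 -> exceedance l tau xi = 0.
Proof.
move=> tau0; rewrite /exceedance (_ : exceed_set _ _ _ = set0).
  by rewrite /lebesgue_length measure0.
by rewrite -subset0 => s [/andP[s0 st] _];
  have := le_trans s0 st; rewrite leNgt tau0.
Qed.

Lemma le_exceedance l1 l2 tau1 tau2 xi1 xi2 : tau1 <= tau2 -> xi2 <= xi1 ->
  (forall s, 0 <= s <= tau1 -> l1 s <= l2 s) ->
  exceedance l1 tau1 xi1 <= exceedance l2 tau2 xi2.
Proof.
move=> tau12 xi21 l12; rewrite -lee_fin !exceedanceE.
apply: lebesgue_measure_mono => s [/andP[s0 st] xis]; split.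
  by rewrite s0 (le_trans st).
by apply: (le_lt_trans xi21); apply: (lt_le_trans xis); rewrite lerD2r l12// s0.
Qed.

Lemma eq_exceedance l1 l2 tau xi : (forall s, 0 <= s <= tau -> l1 s = l2 s) ->
  exceedance l1 tau xi = exceedance l2 tau xi.
Proof.
by move=> l12; apply/eqP; rewrite eq_le !le_exceedance// => s st; rewrite l12.
Qed.

(** Enlarging [0, tau1] to [0, tau2] adds at most the interval ]tau1, tau2]. *)
Lemma exceedance_slope l tau1 tau2 xi : 0 <= tau1 -> tau1 <= tau2 ->
  exceedance l tau2 xi <= exceedance l tau1 xi + (tau2 - tau1).
Proof.
move=> tau10 tau12; rewrite -lee_fin EFinD !exceedanceE -lebesgue_measure_cc//.
apply: le_trans (lebesgue_measureU2 _ _).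
apply: lebesgue_measure_mono => s [/andP[s0 st] xis].
have [stau1|tau1s] := leP s tau1; [left|right].
  by split => //; rewrite s0.
by rewrite /= in_itv/= st (ltW tau1s).
Qed.

(** Along the diagonal, [exceedance_slope] bounds the growth in tau by that of
    the identity, and the growth of xi can only decrease the exceedance.  As [l] is
    arbitrary, every fixed point acquires locally bounded variation this way. *)
Lemma sub_exceedance_diag_nondecreasing l :
  nondecreasing_fun (fun t => t - exceedance l t t).
Proof.
move=> t1 t2 t12; have [t20|t20] := ltP t2 0.
  by rewrite !exceedance_lt0// ?subr0// (le_lt_trans t12).
have [t10|t10] := ltP t1 0.
  rewrite (exceedance_lt0 _ _ t10) subr0 (le_trans (ltW t10))//.
  by rewrite subr_ge0 exceedance_le.
have := @exceedance_slope l _ _ t2 t10 t12.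
have := @le_exceedance l l t1 t1 t2 t1 (lexx _) t12 (fun _ _ => lexx _).
lra.
Qed.

Lemma BVloc_exceedance_diag l : BVloc (fun t => exceedance l t t).
Proof.
move=> a a0.
have -> : (fun t => exceedance l t t) =
          id \+ (\- (fun t => t - exceedance l t t)).
  by apply/funext => t /=; rewrite opprB addrC subrK.
apply: bounded_variationD => //.
  by apply: nondecreasing_bounded_variation.
apply: bounded_variationN; apply: nondecreasing_bounded_variation.
by move=> x y _ _; exact: sub_exceedance_diag_nondecreasing.
Qed.

(** The nonlocal equation after the reflection of [s] into [t - s]; the
    equivalence is [nonlocal_solutionP]. *)
Definition diagonal_solution u l :=
  [/\ BVloc l, nonneg l & forall t, 0 <= t -> l t = u t + exceedance l t t].

(** The supremum of all subsolutions is a solution: the exceedance is monotone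
    in the function, and each subsolution is bounded by u(t) + t. *)
Lemma diagonal_solution_exists u : BVloc u -> nonneg u ->
  exists l, diagonal_solution u l.
Proof.
move=> BVu u0; pose Phi l t := u t + exceedance l t t.
have le_Phi l1 l2 : (forall t, 0 <= t -> l1 t <= l2 t) ->
    forall t, 0 <= t -> Phi l1 t <= Phi l2 t.
  move=> l12 t t0; rewrite lerD2l le_exceedance// => s /andP[s0 _].
  exact: l12.
have Phi_ge0 l t : 0 <= t -> 0 <= Phi l t.
  by move=> t0; rewrite addr_ge0 ?exceedance_ge0 ?u0.
pose S := [set f | forall t, 0 <= t -> f t <= Phi f t].
pose l t := sup [set f t | f in S].
have S_le f t : S f -> 0 <= t -> f t <= l t.
  move=> Sf t0; apply: ub_le_sup; last by exists f.
  exists (u t + t) => _ [g Sg <-]; rewrite (le_trans (Sg t t0))//.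
  by rewrite lerD2l exceedance_le.
have l_le t x : 0 <= t -> (forall f, S f -> f t <= x) -> l t <= x.
  move=> t0 Sx; apply: ge_sup; last by move=> _ [f Sf <-]; exact: Sx.
  by exists 0, (cst 0) => // s s0; exact: Phi_ge0.
have Sl : S l.
  move=> t t0; apply: l_le => // f Sf; rewrite (le_trans (Sf _ t0))//.
  by apply: le_Phi => // s s0; exact: S_le.
have lE t : 0 <= t -> l t = Phi l t.
  move=> t0; apply/eqP; rewrite eq_le Sl//=.
  by apply: (S_le (Phi l)) => // s s0; apply: le_Phi.
(* [l] and [Phi l] agree on [0, +oo[, and the variation of [Phi l] can be read
   off its formula. *)
exists (Phi l); split.
- by move=> a a0; apply: bounded_variationD => //;
    [exact: BVu|exact: BVloc_exceedance_diag].
- by move=> t t0; exact: Phi_ge0.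
- move=> t t0; rewrite /Phi; congr (_ + _); apply: eq_exceedance.
  by move=> s /andP[s0 _]; rewrite lE.
Qed.

(** * Jumps of a solution *)

Lemma nondecreasing_one_sided_limits f t : nondecreasing_fun f ->
  exists a b, [/\ f x @[x --> t^'-] --> a, f x @[x --> t^'+] --> b & a <= b].
Proof.
move=> ndf.
have fl : cvg (f x @[x --> t^'-]).
  apply: nondecreasing_at_left_is_cvgr.
    by apply: nearW => x y z *; apply: ndf.
  apply: nearW => x; exists (f t) => _ [y + <-].
  by rewrite /= in_itv => /andP[_ yt]; exact/ndf/ltW.
have fr : cvg (f x @[x --> t^'+]).
  apply: nondecreasing_at_right_is_cvgr.
    by apply: nearW => x y z *; apply: ndf.
  apply: nearW => x; exists (f t) => _ [y + <-].
  by rewrite /= in_itv => /andP[ty _]; exact/ndf/ltW.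
exists (lim (f x @[x --> t^'-])), (lim (f x @[x --> t^'+])); split => //.
apply: (@le_trans _ _ (f t)).
  apply: limr_le => //; near=> x; apply: ndf.
  by near: x; apply: nbhs_left_le.
apply: limr_ge => //; near=> x; apply: ndf.
by near: x; apply: nbhs_right_ge.
Unshelve. all: by end_near. Qed.

(** The difference l - u is the identity minus a nondecreasing function, so its
    one-sided limits exist and it can only jump downwards. *)
Lemma diagonal_solution_jump u l t : 0 < t -> diagonal_solution u l ->
  exists a b, [/\ a <= b, (l x - u x) @[x --> t^'-] --> t - a &
                           (l x - u x) @[x --> t^'+] --> t - b].
Proof.
move=> t0 [_ _ lE].
have [a [b [Da Db ab]]] :=
  nondecreasing_one_sided_limits t (@sub_exceedance_diag_nondecreasing l).
have luE x : 0 <= x -> x - (x - exceedance l x x) = l x - u x.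
  by move=> x0; rewrite lE//; lra.
exists a, b; split => //.
- have idt : x @[x --> t^'-] --> t by apply: cvg_at_left_filter; exact: cvg_id.
  apply: cvg_trans; last exact: cvgB idt Da.
  by apply: near_eq_cvg; near=> x; apply: luE; near: x; exact: nbhs_left_ge.
- have idt : x @[x --> t^'+] --> t by apply: cvg_at_right_filter; exact: cvg_id.
  apply: cvg_trans; last exact: cvgB idt Db.
  apply: near_eq_cvg; near=> x; apply: luE; apply: (le_trans (ltW t0)).
  by near: x; exact: nbhs_right_ge.
Unshelve. all: by end_near. Qed.

Lemma diagonal_solution_increasing_jump u l t : 0 < t ->
  diagonal_solution u l -> increasing_jump l t -> increasing_jump u t.
Proof.
move=> t0 /(diagonal_solution_jump t0)[a [b [ab la lb]]] [c [d [lc ld cd]]].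
have uE : u = fun x => l x - (l x - u x).
  by apply/funext => x; rewrite opprB addrC subrK.
exists (c - (t - a)), (d - (t - b)); rewrite uE; split; last lra.
- exact: cvgB.
- exact: cvgB.
Qed.

Lemma diagonal_solution_decreasing_jump u l t : 0 < t ->
  diagonal_solution u l -> decreasing_jump u t -> decreasing_jump l t.
Proof.
move=> t0 /(diagonal_solution_jump t0)[a [b [ab la lb]]] [c [d [uc ud cd]]].
have lE : l = fun x => u x + (l x - u x).
  by apply/funext => x; rewrite addrC subrK.
exists (c + (t - a)), (d + (t - b)); rewrite lE; split; last lra.
- exact: cvgD.
- exact: cvgD.
Qed.

(** * Uniqueness for data positive near the origin *)

(** One constant serves both as the lower bound and as the length of the
    interval, which is the form in which the bound propagates. *)
Lemma right_continuous_pos_near0 u : u x @[x --> 0^'+] --> u 0 -> 0 < u 0 ->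
  exists2 c, 0 < c & forall t, 0 <= t <= c -> c <= u t.
Proof.
move=> urc u00.
have /cvgrPdist_lt/(_ (u 0 / 2)) := urc.
have u02 : 0 < u 0 / 2 by lra.
move=> /(_ u02)[d /= d0 Hd].
exists (Num.min (d / 2) (u 0 / 2)); first by rewrite lt_min; lra.
move=> t /andP[t0]; rewrite le_min => /andP[td _].
rewrite ge_min; apply/orP; right.
move: t0; rewrite le_eqVlt => /predU1P[<-|t0]; first lra.
have := Hd t; rewrite /ball_/= sub0r normrN gtr0_norm// => /(_ _ t0).
move=> H; have /H : t < d by lra.
rewrite ltr_distl => /andP[]; lra.
Qed.

(** The bound propagates by steps of length c / 2.  Suppose l >= c on [0, T]
    with T >= c.  For t in ]T, T + c / 2], the times in ]t - c, T] all satisfy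
    l(s) + s > t, and their length is at least c / 2, so l >= c / 2 on
    ]T, T + c / 2].  With this weaker bound the times in ]T, t] count as well,
    so the whole of ]t - c, t] does, and l(t) >= c. *)
Lemma diagonal_solution_ge u l c : 0 < c -> nonneg u ->
  (forall t, 0 <= t <= c -> c <= u t) -> diagonal_solution u l ->
  forall t, 0 <= t -> c <= l t.
Proof.
move=> c0 u0 uc [_ _ lE].
have c20 : 0 < c / 2 by lra.
suff ge_c n t : 0 <= t <= c + n%:R * (c / 2) -> c <= l t.
  move=> t t0; have [n tn] : exists n, t <= n%:R * (c / 2).
    exists (Num.truncn (t / (c / 2))).+1.
    by rewrite -ler_pdivrMr// ltW// truncnS_gt.
  by apply: (ge_c n); rewrite t0/=; lra.
elim: n t => [|n IH] t.
  rewrite mul0r addr0 => tc; rewrite lE; last by case/andP: tc.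
  by rewrite (le_trans (uc _ tc))// lerDl exceedance_ge0.
set T := c + n%:R * (c / 2) in IH *.
have Tc : c <= T by rewrite lerDl mulr_ge0// ltW.
have -> : c + n.+1%:R * (c / 2) = T + c / 2 by rewrite /T -natr1; lra.
move=> /andP[t0 tT]; have [tleT|Tt] := leP t T; first by apply: IH; rewrite t0.
(* A whole interval of counted times bounds the exceedance from below. *)
have exc_ge s x y : 0 <= x -> x <= y -> y <= s ->
    (forall r, x < r < y -> s < l r + r) -> y - x <= exceedance l s s.
  move=> x0 xy ys H; rewrite -lee_fin exceedanceE -lebesgue_measure_cc//.
  have -> : mu `[x, y] = mu `]x, y[.
    by rewrite !lebesgue_measure_itv.
  apply: lebesgue_measure_mono => r; rewrite /= in_itv/= => /andP[xr ry].
  split; last by apply: H; rewrite xr.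
  by rewrite (le_trans x0 (ltW xr)) (le_trans (ltW ry)).
have half r : T < r <= T + c / 2 -> c / 2 <= l r.
  move=> /andP[Tr rT]; have r0 : 0 <= r by lra.
  have : T - (r - c) <= exceedance l r r.
    apply: exc_ge; [lra|lra|lra|] => s /andP[s1 s2].
    have : c <= l s by apply: IH; lra.
    lra.
  by have := u0 r r0; rewrite lE//; lra.
have : t - (t - c) <= exceedance l t t.
  apply: exc_ge; [lra|lra|lra|] => s /andP[s1 s2].
  have [sT|Ts] := leP s T.
    have : c <= l s by apply: IH; lra.
    lra.
  have : c / 2 <= l s by apply: half; lra.
  lra.
by have := u0 t t0; rewrite lE//; lra.
Qed.

(** Since l >= c, all the times in ]t - c, t] are counted for both solutions, so
    the equation at t involves only values before t - c. *)
Lemma diagonal_solution_unique u c l1 l2 : 0 < c -> nonneg u ->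
  (forall t, 0 <= t <= c -> c <= u t) ->
  diagonal_solution u l1 -> diagonal_solution u l2 ->
  forall t, 0 <= t -> l1 t = l2 t.
Proof.
move=> c0 u0 uc sl1 sl2.
have l1c := diagonal_solution_ge c0 u0 uc sl1.
have l2c := diagonal_solution_ge c0 u0 uc sl2.
have [_ _ l1E] := sl1; have [_ _ l2E] := sl2.
suff eq_n n t : 0 <= t -> t < n%:R * c -> l1 t = l2 t.
  move=> t t0; apply: (eq_n (Num.truncn (t / c)).+1) => //.
  by rewrite -ltr_pdivrMr// truncnS_gt.
elim: n t => [|n IH] t t0; first by rewrite mul0r ltNge t0.
rewrite -natr1 mulrDl mul1r => tn.
rewrite l1E// l2E//; congr (_ + lebesgue_length _); apply/seteqP.
split=> s [/andP[s0 st] H]; split; rewrite ?s0//.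
  have [sn|ns] := ltP s (n%:R * c); first by rewrite -IH.
  have := l2c _ s0; lra.
have [sn|ns] := ltP s (n%:R * c); first by rewrite IH.
have := l1c _ s0; lra.
Qed.

(** * Measurability and reflection *)

Lemma nondecreasing_itv_measurable (a b : R) f : a <= b ->
  {in `[a, b] &, {homo f : x y / x <= y}} -> measurable_fun `[a, b] f.
Proof.
(* Clamping the argument to [a, b] makes the function monotone on the line. *)
move=> ab ndf; pose clamp x := Num.max a (Num.min b x).
have clamp_in x : clamp x \in `[a, b].
  by rewrite in_itv/= le_max lexx/= ge_max ab ge_min lexx.
apply: (@eq_measurable_fun _ _ _ _ _ (f \o clamp)).
  move=> x; rewrite inE/= in_itv/= => /andP[ax xb].
  by rewrite /clamp min_r// max_r.
apply: nondecreasing_measurable => // x y xy; apply: ndf => //.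
rewrite /clamp ge_max le_max lexx/= le_max; apply/orP; right.
by rewrite le_min !ge_min lexx xy orbT.
Qed.

(** On each [0, n + 1] the function is the difference of two monotone
    functions, its positive and negative variations. *)
Lemma BVloc_measurable f : BVloc f -> measurable_fun `[0 : R, +oo[ f.
Proof.
move=> BVf.
have -> : `[0, +oo[%classic = \bigcup_n `[0, n.+1%:R]%classic :> set R.
  apply/seteqP; split => x /=; rewrite in_itv/= ?andbT.
    move=> x0; exists (Num.truncn x) => //=.
    by rewrite in_itv/= x0 ltW// truncnS_gt.
  by move=> [n _]; rewrite /= in_itv/= => /andP[].
apply/measurable_fun_bigcup => // n.
have BVn := BVf n.+1%:R (ltr0Sn _ _).
apply: (@eq_measurable_fun _ _ _ _ _
    ((fine \o pos_tv 0 f) \- (fine \o neg_tv 0 f))).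
  by move=> x; rewrite inE/= => xn; rewrite (bounded_variation_pos_neg_tvE BVn).
apply: measurable_funB; apply: nondecreasing_itv_measurable => //.
  exact/fine_neg_tv_nondecreasing/bounded_variationN.
exact: fine_neg_tv_nondecreasing.
Qed.

Lemma lebesgue_measure_reflect t A : measurable A ->
  mu [set s | A (t - s)] = mu A.
Proof.
have mr : measurable_fun [set: measurableTypeR R]
    ((fun s => t - s) : R -> measurableTypeR R).
  by apply: measurable_funB.
move=> mA.
rewrite -[LHS]/(pushforward mu ((fun s => t - s) : R -> measurableTypeR R) A).
apply/esym/lebesgue_measure_unique => //= _ [[a b]] _ <-.
rewrite /pushforward (_ : _ @^-1` _ = `[t - b, t - a[%classic); last first.
  apply/seteqP; split => s /=; rewrite !in_itv/= => /andP[? ?];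
    by apply/andP; lra.
rewrite !lebesgue_measure_itv/= !lte_fin ltrD2l ltrN2.
by case: ifP => // _; rewrite -!EFinB; congr EFin; lra.
Qed.

Lemma measurable_exceed_set l tau xi : measurable_fun `[0 : R, +oo[ l ->
  measurable (exceed_set l tau xi).
Proof.
move=> ml.
have mL : measurable_fun `[0 : R, +oo[ (fun s => l s + s).
  by apply: (measurable_funD ml).
have -> : exceed_set l tau xi = `[0, tau] `&`
    (`[0, +oo[ `&` (fun s => l s + s) @^-1` `]xi, +oo[).
  apply/seteqP; split => s /=; rewrite !in_itv/= !andbT.
    by move=> [/andP[s0 st] xis]; rewrite s0 st.
  by move=> [/andP[s0 st] [_ xis]]; split => //; rewrite s0.
by apply: measurableI => //; apply: mL.
Qed.

Lemma nonlocal_solutionP u l : nonlocal_solution u l <-> diagonal_solution u l.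
Proof.
have lenE t : BVloc l ->
    lebesgue_length [set s | 0 <= s <= t /\ s < l (t - s)] = exceedance l t t.
  move=> /BVloc_measurable ml; congr fine.
  rewrite -(lebesgue_measure_reflect t (measurable_exceed_set t t ml)).
  congr (mu _); apply/seteqP; split => s [/andP[s0 st] H]; split.
  - by apply/andP; lra.
  - lra.
  - by apply/andP; lra.
  - lra.
by split=> -[BVl l0 lE]; split => // t t0; rewrite lE// lenE.
Qed.

(** * Trace and integral form of the exceedance *)

(** The sets {l(s) + s > xi} increase to {l(s) + s > tau} as xi decreases to
    tau, and measures are continuous from below. *)
Lemma exceedance_right_cvg l tau : 0 <= tau -> measurable_fun `[0 : R, +oo[ l ->
  exceedance l tau xi @[xi --> tau^'+] --> exceedance l tau tau.
Proof.
move=> tau0 ml; pose E n := exceed_set l tau (tau + n.+1%:R^-1).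
have mE n : measurable (E n) by exact: measurable_exceed_set.
have UE : \bigcup_n E n = exceed_set l tau tau.
  apply/seteqP; split => [s [n _ [st xis]]|s [st xis]].
    by split => //; apply: lt_trans xis; rewrite ltrDl.
  have d0 : 0 < l s + s - tau by rewrite subr_gt0.
  exists (Num.truncn (l s + s - tau)^-1) => //; split => //.
  rewrite -ltrBrDl -[ltRHS]invrK ltf_pV2 ?posrE ?invr_gt0//.
  by rewrite truncnS_gt.
have ndE : nondecreasing_seq E.
  move=> n m nm; apply/subsetPset => s [st xis]; split => //.
  by apply: le_lt_trans xis; rewrite lerD2l lef_pV2 ?posrE// ler_nat.
have /fine_cvgP[_ cvgE] : mu (E n) @[n --> \oo] --> (exceedance l tau tau)%:E.
  rewrite exceedanceE -UE; apply: nondecreasing_cvg_mu => //.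
  by apply: bigcup_measurable => n _; exact: mE.
apply/cvgrPdist_le => e e0.
have /cvgrPdist_le/(_ _ e0)[N _ /(_ N (leqnn _))] := cvgE => /=.
rewrite -/(lebesgue_length (E N)) -/(exceedance l tau (tau + N.+1%:R^-1)) => HN.
near=> xi.
have xi1 : tau <= xi by near: xi; exact: nbhs_right_ge.
have xi2 : xi <= tau + N.+1%:R^-1.
  by near: xi; apply: nbhs_right_le; rewrite ltrDl.
have le1 : exceedance l tau xi <= exceedance l tau tau by apply: le_exceedance.
have le2 : exceedance l tau (tau + N.+1%:R^-1) <= exceedance l tau xi.
  by apply: le_exceedance.
move: HN; rewrite !ger0_norm ?subr_ge0//; last exact: le_trans le1.
by apply: le_trans; rewrite lerD2l lerN2.
Unshelve. all: by end_near. Qed.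

Lemma exceedance_Rintegral l tau xi : measurable_fun `[0 : R, +oo[ l ->
  \int[mu]_(s in `]0, tau]) \1_(`]xi, +oo[) (l s + s) = exceedance l tau xi.
Proof.
move=> ml; have mE := measurable_exceed_set tau xi ml.
have indE s : s \in `]0, tau]%classic ->
    \1_(`]xi, +oo[) (l s + s) = \1_(exceed_set l tau xi) s :> R.
  rewrite inE/= in_itv/= => /andP[s0 st]; rewrite !indicE; congr ((nat_of_bool _)%:R).
  apply/idP/idP; rewrite !inE/= in_itv/= andbT.
    by move=> xis; split => //; rewrite ltW.
  by case.
transitivity (\int[mu]_(s in `]0, tau]) \1_(exceed_set l tau xi) s)%R.
  by apply: eq_Rintegral => s; exact: indE.
rewrite /Rintegral; congr fine.
rewrite integral_itv_obnd_cbnd; last first.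
  apply/measurable_EFinP; apply: measurable_funTS; exact: measurable_indic.
rewrite integral_indic// setIidl//; exact: exceed_set_sub.
Qed.

(** Solutions matter only on [0, +oo[; extending them by 0 gives functions
    measurable on the whole line, to be combined with projections of product
    spaces. *)
Let rstr l : R -> R := l \_ `[0, +oo[.

Let rstrE l s : 0 <= s -> rstr l s = l s.
Proof. by move=> s0; rewrite /rstr patchE mem_set//= in_itv/= s0. Qed.

Let measurable_rstr l :
  measurable_fun `[0 : R, +oo[ l -> measurable_fun setT (rstr l).
Proof. move=> ml; exact/(measurable_restrictT _ _).1. Qed.

(** The exceedance is the measure of the sections of a measurable subset of
    three-dimensional space, so Tonelli's theorem gives joint measurability. *)
Lemma measurable_exceedance l : measurable_fun `[0 : R, +oo[ l ->
  measurable_fun [set: R * R] (fun p => exceedance l p.1 p.2).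
Proof.
move=> /measurable_rstr ml.
pose B := [set q : (R * R) * R | (0 <= q.2) && (q.2 <= q.1.1) &&
                                 (q.1.2 < rstr l q.2 + q.2)].
have mB : measurable B.
  apply: measurable_bool_set; apply: measurable_and; first apply: measurable_and.
  - by apply: measurable_fun_ler.
  - by apply: measurable_fun_ler => //; exact: measurableT_comp.
  - apply: measurable_fun_ltr; first exact: measurableT_comp.
    by apply: measurable_funD => //; exact: measurableT_comp.
have -> : (fun p => exceedance l p.1 p.2) = fine \o (mu \o xsection B).
  apply/funext => p; congr (fine (mu _)).
  apply/seteqP; split => s.
    by move=> [/andP[s0 st] xis]; rewrite /xsection /= inE /B/= rstrE// s0 st.
  rewrite /xsection /= inE /B/= => /andP[/andP[s0 st]].
  by rewrite rstrE// => xis; split => //; rewrite s0.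
apply: measurableT_comp => //; exact: measurable_fun_xsection.
Qed.

Lemma measurable_exceedance_diag l : measurable_fun `[0 : R, +oo[ l ->
  measurable_fun [set: R] (fun t => exceedance l t t).
Proof.
move=> ml; rewrite (_ : (fun t => exceedance l t t) =
  (fun p : R * R => exceedance l p.1 p.2) \o (fun t => (t, t)))//.
apply: measurableT_comp; first exact: measurable_exceedance.
exact: measurable_fun_pair.
Qed.

Lemma measurable_v_of u l : measurable_fun `[0 : R, +oo[ u ->
  measurable_fun `[0 : R, +oo[ l -> lebesgue_measurable_on wedge (v_of u l).
Proof.
move=> mu0 ml B mB.
pose v p := rstr u p.2 + exceedance l p.1 p.2.
have mv : measurable_fun [set: R * R] v.
  apply: measurable_funD; last exact: measurable_exceedance.
  by apply: measurableT_comp => //; exact: measurable_rstr.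
have mW : measurable (@wedge R).
  rewrite (_ : wedge = [set p : R * R | (0 < p.1) && (p.1 < p.2)]).
    apply: measurable_bool_set.
    by apply: measurable_and; apply: measurable_fun_ltr.
  by apply/seteqP; split => p /=; [move=> [? ?]; apply/andP|move/andP].
exists (wedge `&` v @^-1` B).
  by apply: measurableI => //; rewrite -[X in measurable X]setTI; exact: mv.
exists set0; first exact: negligible_set0.
rewrite setU0; apply/seteqP; split => p [[p1 p2]] /= Bp; split => //=;
  by move: Bp; rewrite /v/= rstrE// (le_trans (ltW p1))// ltW.
Qed.

(** Both sides measure the set of all (s, x) with 0 <= s <= tau and
    s <= x < l(s) + s.  Its section at s in [0, tau] has length l(s).  Its
    section at x >= 0 is {s in [0, x] : l(s) + s > x} when x <= tau, because of
    the constraint s <= x, and {s in [0, tau] : l(s) + s > x} when x > tau. *)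
Lemma exceedance_tonelli l tau : 0 <= tau -> measurable_fun `[0 : R, +oo[ l ->
  nonneg l ->
  (\int[mu]_(s in `[0%R, tau]) (l s)%:E =
   \int[mu]_(x in `[0%R, tau]) (exceedance l x x)%:E +
   \int[mu]_(x in `]tau, +oo[) (exceedance l tau x)%:E)%E.
Proof.
move=> tau0 ml l0.
pose E := [set q : R * R | (0 <= q.1) && (q.1 <= tau) && (q.1 <= q.2) &&
                           (q.2 < rstr l q.1 + q.1)].
have mE : measurable E.
  apply: measurable_bool_set; apply: measurable_and.
    apply: measurable_and; first apply: measurable_and.
    - by apply: measurable_fun_ler.
    - by apply: measurable_fun_ler.
    - by apply: measurable_fun_ler.
  apply: measurable_fun_ltr => //; apply: measurable_funD => //.
  by apply: measurableT_comp => //; exact: measurable_rstr.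
have := @indic_fubini_tonelli _ _ _ _ _ mu mu E mE.
rewrite indic_fubini_tonelli_FE// indic_fubini_tonelli_GE//.
have -> : (\int[mu]_x (mu \o xsection E) x =
    \int[mu]_(s in `[0%R, tau]) (l s)%:E)%E.
  rewrite [RHS]integral_mkcond; apply: eq_integral => s _ /=.
  rewrite patchE; case: ifPn => [|/negP]; rewrite inE/= in_itv/=.
    move=> /andP[s0 st]; rewrite (_ : xsection E s = `[s, l s + s[%classic).
      rewrite lebesgue_measure_itv/= lte_fin ltrDr.
      have := l0 _ s0; rewrite le_eqVlt => /predU1P[<-|->]; first by rewrite ltxx.
      by rewrite -EFinB addrK.
    apply/seteqP; split => x; rewrite /xsection /= inE /E/= in_itv/= rstrE//.
      by move=> /andP[/andP[_ ->] ->].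
    by move=> /andP[-> ->]; rewrite s0 st.
  move=> nst; rewrite (_ : xsection E s = set0) ?measure0//.
  rewrite -subset0 => x; rewrite /xsection /= inE /E/=.
  by move=> /andP[/andP[st _] _]; exact: nst.
move=> ->; rewrite [X in _ = (X + _)%E]integral_mkcond.
rewrite [X in _ = (_ + X)%E]integral_mkcond -ge0_integralD//.
- apply: eq_integral => x _ /=; rewrite !patchE.
  have secE : (ysection E x) =
      [set s | 0 <= s <= tau /\ s <= x /\ x < l s + s].
    apply/seteqP; split => s; rewrite /ysection /= inE /E/=.
      by move=> /andP[/andP[/andP[s0 st] sx]]; rewrite rstrE// s0 st.
    by move=> [/andP[s0 st] [sx xs]]; rewrite rstrE// s0 st sx.
  have [x0|x0] := ltP x 0.
    rewrite !memNset/= ?in_itv/= ?andbT; [|lra|lra].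
    rewrite adde0 secE (_ : [set _ | _] = set0) ?measure0//.
    by rewrite -subset0 => s [/andP[s0 st] [sx _]]; lra.
  have [xt|tx] := leP x tau.
    rewrite mem_set/= ?in_itv/= ?x0// memNset/= ?in_itv/= ?andbT; last lra.
    rewrite adde0 exceedanceE secE; congr (mu _); apply/seteqP; split => s.
      by move=> [/andP[s0 st] [sx xs]]; split => //; rewrite s0.
    by move=> [/andP[s0 sx] xs]; split => //; rewrite s0 (le_trans sx).
  rewrite memNset/= ?in_itv/=; last lra.
  rewrite mem_set/= ?in_itv/= ?tx// add0e exceedanceE secE; congr (mu _).
  apply/seteqP; split => s.
    by move=> [st [sx xs]]; split.
  by move=> [/andP[s0 st] xs]; split; [rewrite s0|split => //; lra].
- by move=> x _; rewrite patchE; case: ifP => // _; rewrite lee_fin exceedance_ge0.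
- apply/(measurable_restrictT _ _).1 => //. apply/measurable_EFinP.
  apply: measurable_funTS.
  exact: measurable_exceedance_diag.
- by move=> x _; rewrite patchE; case: ifP => // _; rewrite lee_fin exceedance_ge0.
- apply/(measurable_restrictT _ _).1 => //. apply/measurable_EFinP.
  apply: measurable_funTS; apply: nonincreasing_measurable => // x y xy.
  exact: le_exceedance.
Qed.

(** * The integral problem *)

Lemma BVloc_bounded f a : BVloc f -> 0 < a ->
  exists M, forall x, 0 <= x <= a -> `|f x| <= M.
Proof.
move=> BVf a0; have /(bounded_variationP _ (ltW a0)) TVfin := BVf a a0.
exists (fine (total_variation 0 a f) + `|f 0|) => x /andP[x0 xa].
rewrite -lerBlDr (le_trans (lerB_dist _ _))// -lee_fin fineK//.
rewrite (le_trans (total_variation_ge _ x0))// (total_variationD f x0 xa).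
by rewrite leeDl// total_variation_ge0.
Qed.

Lemma v_of_locally_bounded u l : BVloc u ->
  [locally [bounded v_of u l p | p in @wedge R]].
Proof.
move=> BVu p [p1 p12].
have p20 : 0 < p.2 + 1 by lra.
have [M uM] := BVloc_bounded BVu p20.
exists (M + (p.1 + 1)); split; first exact: num_real.
move=> N MN.
have near1 : \forall q \near p, q.1 < p.1 + 1.
  have /cvgr_lt : fst q @[q --> p] --> p.1 by exact: cvg_fst.
  by apply; rewrite ltrDl.
have near2 : \forall q \near p, q.2 < p.2 + 1.
  have /cvgr_lt : snd q @[q --> p] --> p.2 by exact: cvg_snd.
  by apply; rewrite ltrDl.
rewrite /within/=; near=> q => -[q1 q12]; apply: le_trans (ltW MN).
have q1p : q.1 < p.1 + 1 by near: q.
have q2p : q.2 < p.2 + 1 by near: q.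
rewrite (le_trans (ler_normD _ _))// lerD//; first by apply: uM; lra.
rewrite ger0_norm; last exact: exceedance_ge0.
by rewrite (le_trans (exceedance_le _ _ (ltW q1)))// ltW.
Unshelve. all: by end_near. Qed.

Lemma v_of_right_cvg u l tau : 0 < tau -> u x @[x --> tau^'+] --> u tau ->
  diagonal_solution u l ->
  v_of u l (tau, xi) @[xi --> tau^'+] --> l tau.
Proof.
move=> tau0 utau [BVl _ lE]; rewrite lE; last exact: ltW.
apply: cvgD => //; apply: exceedance_right_cvg; first exact: ltW.
exact: BVloc_measurable.
Qed.

Lemma v_of_free_boundary u l : admissible_datum u ->
  diagonal_solution u l -> has_free_boundary (v_of u l) l.
Proof.
move=> [_ _ urc] sl tau tau0; apply/cvg_lim => //.
by apply: v_of_right_cvg => //; apply: urc; exact: ltW.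
Qed.

(** The integral equation sees the unknown only through its trace on ]0, tau],
    so its right-hand side is v as soon as the trace is [l].  This gives both
    the equation for v and the uniqueness of its solution. *)
Lemma free_boundary_Rintegral u l w tau xi : BVloc l ->
  has_free_boundary w l ->
  u xi + \int[mu]_(s in `]0, tau]) \1_(`]xi, +oo[) (diag_trace w s + s) =
  v_of u l (tau, xi).
Proof.
move=> BVl wl; congr (_ + _).
rewrite -[RHS]exceedance_Rintegral; last exact: BVloc_measurable.
by apply: eq_Rintegral => s; rewrite inE/= in_itv/= => /andP[s0 _]; rewrite wl.
Qed.

Lemma v_of_integral_solution u l : admissible_datum u ->
  diagonal_solution u l -> integral_solution u (v_of u l).
Proof.
move=> au sl; have [BVu u0 urc] := au; have [BVl _ _] := sl; split.
- move=> p [p1 p2]; apply: addr_ge0; last exact: exceedance_ge0.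
  by apply: u0; rewrite (le_trans (ltW p1))// ltW.
- exact: v_of_locally_bounded.
- by apply: measurable_v_of; exact: BVloc_measurable.
- move=> tau tau0; apply/cvg_ex; exists (l tau).
  by apply: v_of_right_cvg => //; apply: urc; exact: ltW.
- move=> tau xi tau0 xitau; rewrite (free_boundary_Rintegral _ _ _ BVl)//.
  exact: v_of_free_boundary.
Qed.

Lemma integral_solution_unique u l w : BVloc l -> integral_solution u w ->
  has_free_boundary w l -> forall p, wedge p -> w p = v_of u l p.
Proof.
move=> BVl [_ _ _ _ wE] wl [tau xi] [/= tau0 xitau].
by rewrite wE// (free_boundary_Rintegral _ _ _ BVl).
Qed.

(** * Conservation of mass and unilateral Lipschitz bound *)

Lemma v_of_mass u l tau : 0 < tau -> admissible_datum u ->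
  diagonal_solution u l ->
  (\int[mu]_(xi in `]tau, +oo[) (v_of u l (tau, xi))%:E =
   \int[mu]_(xi in `[0%R, +oo[) (u xi)%:E)%E.
Proof.
move=> tau0 [BVu u0 _] [BVl l0 lE].
have mu0 := BVloc_measurable BVu; have ml := BVloc_measurable BVl.
have mH := measurable_exceedance_diag ml.
have sub1 : `[0, tau]%classic `<=` (`[0, +oo[%classic : set R).
  by move=> x; rewrite /= !in_itv/= => /andP[->].
have sub2 : `]tau, +oo[%classic `<=` (`[0, +oo[%classic : set R).
  by move=> x; rewrite /= !in_itv/= !andbT => /ltW; exact/le_trans/ltW.
have intl : (\int[mu]_(s in `[0%R, tau]) (l s)%:E =
    \int[mu]_(s in `[0%R, tau]) (u s)%:E +
    \int[mu]_(s in `[0%R, tau]) (exceedance l s s)%:E)%E.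
  rewrite -ge0_integralD//.
  - apply: eq_integral => s; rewrite inE/= in_itv/= => /andP[s0 _].
    by rewrite lE.
  - by move=> s; rewrite /= in_itv/= => /andP[s0 _]; rewrite lee_fin u0.
  - apply/measurable_EFinP; apply: measurable_funS mu0 => //.
  - by move=> s _; rewrite lee_fin exceedance_ge0.
  - by apply/measurable_EFinP; exact: measurable_funTS.
have Hfin : (\int[mu]_(s in `[0%R, tau]) (exceedance l s s)%:E)%E \is a fin_num.
  rewrite ge0_fin_numE; last first.
    by apply: integral_ge0 => s _; rewrite lee_fin exceedance_ge0.
  apply: (@le_lt_trans _ _ (\int[mu]_(s in `[0%R, tau]) (cst tau%:E s))%E).
    apply: ge0_le_integral => //.
    - by move=> s _; rewrite lee_fin exceedance_ge0.
    - by apply/measurable_EFinP; exact: measurable_funTS.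
    - move=> s; rewrite /= in_itv/= => /andP[s0 st].
      by rewrite lee_fin (le_trans (exceedance_le _ _ s0)).
  by rewrite integral_cst//= lebesgue_measure_cc ?(ltW tau0)// -EFinM ltry.
(* The diagonal exceedance has a finite integral over [0, tau], so it cancels
   between the nonlocal equation and Tonelli's identity. *)
have intE : (\int[mu]_(x in `]tau, +oo[) (exceedance l tau x)%:E =
             \int[mu]_(s in `[0%R, tau]) (u s)%:E)%E.
  have := exceedance_tonelli (ltW tau0) ml l0.
  rewrite intl [in RHS]addeC => UHE.
  by rewrite -[LHS](addeK _ Hfin) -UHE addeK.
have -> : (`[0, +oo[%classic : set R) = `[0, tau] `|` `]tau, +oo[.
  apply/seteqP; split => x /=; rewrite !in_itv/= !andbT.
    by move=> ->; case: (leP x tau); [left|right].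
  by move=> [/andP[]//|tx]; rewrite (le_trans (ltW tau0))// ltW.
rewrite ge0_integral_setU//=.
- rewrite -intE addeC -ge0_integralD//.
  + by move=> x /sub2; rewrite /= in_itv/= andbT => /u0; rewrite lee_fin.
  + by apply/measurable_EFinP; exact: measurable_funS mu0.
  + by move=> s _; rewrite lee_fin exceedance_ge0.
  + apply/measurable_EFinP; apply: nonincreasing_measurable => // x y xy.
    exact: le_exceedance.
- apply/measurable_EFinP; apply: measurable_funS mu0 => //.
  by move=> x [/sub1|/sub2].
- by move=> x [/sub1|/sub2]; rewrite /= in_itv/= andbT => /u0; rewrite lee_fin.
- apply/disj_setPS => x [] /=; rewrite !in_itv/= andbT => /andP[_ xt].
  by rewrite ltNge xt.
Qed.

Lemma v_of_unilateral_lipschitz u l C :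
  (forall xi h, 0 <= xi -> 0 < h -> u (xi + h) - u xi <= C * h) ->
  forall tau xi h, 0 <= xi -> 0 < h ->
    v_of u l (tau, xi + h) - v_of u l (tau, xi) <= C * h.
Proof.
move=> uC tau xi h xi0 h0; have := uC _ _ xi0 h0.
have : exceedance l tau (xi + h) <= exceedance l tau xi.
  by apply: le_exceedance => //; rewrite lerDl ltW.
rewrite /v_of/= -!/(exceed_set _ _ _) -!/(exceedance _ _ _); lra.
Qed.

(** * A datum whose solutions have a decreasing jump *)

Definition step_down t : R := (t < 1)%R%:R.

Lemma step_down_lt_cvg (F : set_system R) {FF : Filter F} :
  (\forall x \near F, x < 1) -> step_down x @[x --> F] --> (1 : R).
Proof.
move=> F1; apply: cvg_near_cst; near=> x.
by rewrite /step_down (_ : x < 1)//; near: x.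
Unshelve. all: by end_near. Qed.

Lemma step_down_ge_cvg (F : set_system R) {FF : Filter F} :
  (\forall x \near F, 1 <= x) -> step_down x @[x --> F] --> (0 : R).
Proof.
move=> F1; apply: cvg_near_cst; near=> x.
by rewrite /step_down ltNge (_ : 1 <= x)//; near: x.
Unshelve. all: by end_near. Qed.

Lemma step_down_admissible : admissible_datum step_down.
Proof.
split.
- move=> a a0; rewrite (_ : step_down = \- (\- step_down)); last first.
    by apply/funext => x /=; rewrite opprK.
  apply/bounded_variationN/nondecreasing_bounded_variation => x y _ _ xy /=.
  rewrite lerN2 /step_down ler_nat; have [y1|//] := ltP y 1.
  by rewrite (le_lt_trans xy y1).
- by move=> t _; rewrite /step_down ler0n.
- move=> t t0; rewrite [X in _ --> X]/step_down; have [t1|t1] := ltP t 1.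
    apply: step_down_lt_cvg; near=> x.
    by near: x; apply: nbhs_right_lt.
  apply: step_down_ge_cvg; near=> x; apply: (le_trans t1).
  by near: x; exact: nbhs_right_ge.
Unshelve. all: by end_near. Qed.

Lemma step_down_decreasing_jump : decreasing_jump step_down 1.
Proof.
exists 1, 0; split; last exact: ltr01.
- by apply: step_down_lt_cvg; near=> x; near: x; exact: nbhs_left_lt.
- by apply: step_down_ge_cvg; near=> x; near: x; exact: nbhs_right_ge.
Unshelve. all: by end_near. Qed.

End free_boundary.

(** * Well-posedness and properties of the free boundary *)

Theorem theorem1p1 (R : realType) :
  (forall u0 : R -> R, admissible_datum u0 ->
    [/\ exists l : R -> R, nonlocal_solution u0 l,
        (exists2 delta : R, 0 < delta &
            forall t : R, 0 <= t -> t < delta -> 0 < u0 t) ->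
          forall l1 l2 : R -> R,
            nonlocal_solution u0 l1 -> nonlocal_solution u0 l2 ->
            forall t : R, 0 <= t -> l1 t = l2 t &
        forall l : R -> R, nonlocal_solution u0 l ->
          [/\ (exists2 t : R, 0 < t & increasing_jump l t) ->
                exists2 t : R, 0 < t & increasing_jump u0 t,
              [/\ integral_solution u0 (v_of u0 l),
                  has_free_boundary (v_of u0 l) l &
                  forall w : R * R -> R,
                    integral_solution u0 w -> has_free_boundary w l ->
                    forall p : R * R, wedge p -> w p = v_of u0 l p],
              forall tau : R, 0 < tau ->
                (\int[lebesgue_measure]_(xi in `]tau, +oo[)
                   (v_of u0 l (tau, xi))%:E =
                 \int[lebesgue_measure]_(xi in `[0%R, +oo[) (u0 xi)%:E)%E &
              (exists2 C : R, 0 < C & forall xi h : R, 0 <= xi -> 0 < h ->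
                  u0 (xi + h) - u0 xi <= C * h) ->
                forall tau : R, 0 < tau ->
                  exists2 C' : R, 0 < C' & forall xi h : R, tau < xi -> 0 < h ->
                    v_of u0 l (tau, xi + h) - v_of u0 l (tau, xi) <= C' * h]])
  /\
  (exists u0 l : R -> R, [/\ admissible_datum u0, nonlocal_solution u0 l &
     exists2 t : R, 0 < t & decreasing_jump l t]).
Proof.
split=> [u0 au0|].
  have [BVu0 u00 urc] := au0; split.
  - have [l sl] := diagonal_solution_exists BVu0 u00.
    by exists l; apply/nonlocal_solutionP.
  - move=> [d d0 u0d] l1 l2 /nonlocal_solutionP s1 /nonlocal_solutionP s2.
    have [||c c0 u0c] := @right_continuous_pos_near0 _ u0.
    + exact: urc.
    + exact: u0d.
    + exact: (diagonal_solution_unique c0 u00 u0c).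
  - move=> l /nonlocal_solutionP sl; have [BVl _ _] := sl; split.
    + move=> [t t0 lt]; exists t => //.
      exact: diagonal_solution_increasing_jump lt.
    + split; first exact: v_of_integral_solution.
        exact: v_of_free_boundary.
      by move=> w ws wl; exact: integral_solution_unique.
    + by move=> tau tau0; exact: v_of_mass.
    + move=> [C C0 u0C] tau tau0; exists C => // xi h tauxi h0.
      by apply: v_of_unilateral_lipschitz => //; rewrite ltW// (lt_trans tau0).
have au := @step_down_admissible R; have [BVu u0 _] := au.
have [l sl] := diagonal_solution_exists BVu u0.
exists step_down, l; split => //; first exact/nonlocal_solutionP.
by exists 1 => //; apply: diagonal_solution_decreasing_jump sl _ => //;
  exact: step_down_decreasing_jump.
Qed.
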